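(* Let $\mathcal L$ be a semilattice and $(\mathfrak A,(A_i)_{i\in\mathcal L})$ an $\mathcal L$-graded $C^*$-algebra. Then: (i) For all $i,j\in\mathcal L$ with $i\le j$ there is a unique morphism $\varphi_{i,j}:A_j\to M(A_i)$ satisfying $\varphi_{i,j}(y)x=yx$ for $x\in A_i$, $y\in A_j$. The morphisms $\varphi_{i,j}$ satisfy: (a) $\varphi_{i,i}=\mathrm{Id}_{A_i}$ (the canonical inclusion $A_i\subset M(A_i)$) for all $i\in\mathcal L$; (b) for all $i,j\in\mathcal L$, with $k=i\wedge j$, and all $m\le i\wedge j$, we have $\varphi_{k,i}(x)\varphi_{k,j}(y)\in A_k$ and $\varphi_{m,k}(\varphi_{k,i}(x)\varphi_{k,j}(y))=\varphi_{m,i}(x)\varphi_{m,j}(y)$ for all $x\in A_i$, $y\in A_j$. (ii) For all $i,j\in\mathcal L$ there is a unique map $q_{i,j}:A_i\times A_j\to A_{i\wedge j}$ satisfying $q_{i,j}(x,y)=xy$ for $x\in A_i$, $y\in A_j$. The maps $q_{i,j}$ are bilinear and satisfy: (a') $q_{i,i}(x,y)=xy$ for all $i\in\mathcal L$, $x,y\in A_i$; (b') $q_{i,j}(x,y)=q_{j,i}(y^*,x^* )^*$ for all $i,j\in\mathcal L$, $x\in A_i$, $y\in A_j$; (c') $q_{i\wedge j,k}(q_{i,j}(x,y),z)=q_{i,j\wedge k}(x,q_{j,k}(y,z))$ for all $i,j,k\in\mathcal L$, $x\in A_i$, $y\in A_j$, $z\in A_k$.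
   Context: A semilattice is a partially ordered set $\mathcal L$ in which any two elements $k,\ell$ have a greatest lower bound $k\wedge\ell$. A $C^*$-algebra $\mathfrak A$ is $\mathcal L$-graded with components $(A_i)_{i\in\mathcal L}$, written $(\mathfrak A,(A_i)_{i\in\mathcal L})$, if $(A_i)_{i\in\mathcal L}$ is a family of sub-$C^*$-algebras of $\mathfrak A$ which is linearly independent (if $S_i\in A_i$, only finitely many $S_i$ are nonzero and $\sum_i S_i=0$, then all $S_i=0$), total (the linear span of $\bigcup_i A_i$ is dense in $\mathfrak A$), and satisfies $A_iA_j\subset A_{i\wedge j}$ for all $i,j\in\mathcal L$. $M(A)$ denotes the multiplier algebra of $A$, in which $A$ is canonically embedded. Morphisms are $*$-homomorphisms. *)

(* Defs.v *)
From HB Require Import structures.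
From mathcomp Require Import all_boot all_order all_algebra.
From mathcomp Require Import sesquilinear complex.
From mathcomp Require Import boolp classical_sets functions cardinality fsbigop.
From mathcomp Require Import reals topology normedtype.

Set Implicit Arguments.
Unset Strict Implicit.
Unset Printing Implicit Defensive.

Import Order.TTheory GRing.Theory Num.Theory.
Import numFieldNormedType.Exports.

Local Open Scope classical_set_scope.
Local Open Scope ring_scope.

Reserved Notation "x ** y" (at level 40, left associativity).

(* MathComp, MathComp-Analysis and real-closed's complex numbers R[i]. *)

(* MathComp rings are unital whereas C*-algebras need not be, hence a product
   of its own on a complex vector space. *)
HB.mixin Record isStarAlgebra (R : realType) A of GRing.Lmodule R[i] A := {
  amul : A -> A -> A;
  star : A -> A;
  amulA : associative amul;
  amulDl : forall x y z : A, amul (x + y) z = amul x z + amul y z;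
  amulDr : forall x y z : A, amul x (y + z) = amul x y + amul x z;
  amulZl : forall (c : R[i]) (x y : A), amul (c *: x) y = c *: amul x y;
  amulZr : forall (c : R[i]) (x y : A), amul x (c *: y) = c *: amul x y;
  starK : involutive star;
  starD : forall x y : A, star (x + y) = star x + star y;
  starZ : forall (c : R[i]) (x : A), star (c *: x) = Num.conj c *: star x;
  starM : forall x y : A, star (amul x y) = amul (star y) (star x)
}.

#[short(type="starAlgType")]
HB.structure Definition StarAlgebra (R : realType) :=
  {A of GRing.Lmodule R[i] A & isStarAlgebra R A}.

Notation "x ** y" := (amul x y) : ring_scope.

(* The norm of a normedModType R[i] takes values in the nonnegative real
   elements of R[i]; for these the order of R[i] is that of R. *)
HB.mixin Record isCStarNormed (R : realType) A
    of NormedModule R[i] A & StarAlgebra R A := {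
  normr_amul : forall x y : A, `|x ** y| <= `|x| * `|y|;
  normr_starM : forall x : A, `|star x ** x| = `|x| ^+ 2
}.

#[short(type="cstarAlgType")]
HB.structure Definition CStarAlgebra (R : realType) :=
  {A of CompleteNormedModule R[i] A & StarAlgebra R A & isCStarNormed R A}.

(* A norm-closed *-subalgebra; it coerces to the C*-algebra subCStar_type of its
   elements, with val : subCStar_type -> B the inclusion. *)
Record subCStar (R : realType) (B : cstarAlgType R) := SubCStar {
  subCStar_set : set B;
  subCStar0 : subCStar_set 0;
  subCStarD : forall x y, subCStar_set x -> subCStar_set y ->
    subCStar_set (x + y);
  subCStarZ : forall (c : R[i]) x, subCStar_set x -> subCStar_set (c *: x);
  subCStarM : forall x y, subCStar_set x -> subCStar_set y ->
    subCStar_set (x ** y);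
  subCStar_star : forall x, subCStar_set x -> subCStar_set (star x);
  subCStar_closed : closed subCStar_set
}.

Section SubCStarAlgebra.
Context (R : realType) (B : cstarAlgType R) (A : subCStar B).

Definition subCStar_pred : {pred B} := [pred x | x \in subCStar_set A].

Definition subCStar_type := {x : B | subCStar_pred x}.

HB.instance Definition _ := SubChoice.copy subCStar_type {x : B | subCStar_pred x}.

Fact subCStar_submod : submod_closed subCStar_pred.
Proof.
split=> [|c x y xA yA]; first exact: (mem_set (subCStar0 A)).
apply: (@mem_set B (subCStar_set A)).
by apply: subCStarD; [apply: subCStarZ; exact: (set_mem xA)|exact: (set_mem yA)].
Qed.

HB.instance Definition _ :=
  GRing.SubChoice_isSubLmodule.Build R[i] B subCStar_pred subCStar_type
    subCStar_submod.

Implicit Types x y : subCStar_type.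

Fact subCStar_mul_subproof x y : subCStar_pred (val x ** val y).
Proof. by apply/mem_set; apply: subCStarM; apply/set_mem/(valP _). Qed.

Fact subCStar_star_subproof x : subCStar_pred (star (val x)).
Proof. by apply/mem_set; apply: subCStar_star; apply/set_mem/(valP _). Qed.

Definition subCStar_amul x y : subCStar_type := Sub _ (subCStar_mul_subproof x y).

Definition subCStar_starop x : subCStar_type := Sub _ (subCStar_star_subproof x).

Fact subCStar_amulA : associative subCStar_amul.
Proof. by move=> x y z; apply/val_inj; rewrite /= amulA. Qed.

Fact subCStar_amulDl x y z :
  subCStar_amul (x + y) z = subCStar_amul x z + subCStar_amul y z.
Proof. by apply/val_inj; rewrite /= amulDl. Qed.

Fact subCStar_amulDr x y z :
  subCStar_amul x (y + z) = subCStar_amul x y + subCStar_amul x z.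
Proof. by apply/val_inj; rewrite /= amulDr. Qed.

Fact subCStar_amulZl (c : R[i]) x y :
  subCStar_amul (c *: x) y = c *: subCStar_amul x y.
Proof. by apply/val_inj; rewrite /= amulZl. Qed.

Fact subCStar_amulZr (c : R[i]) x y :
  subCStar_amul x (c *: y) = c *: subCStar_amul x y.
Proof. by apply/val_inj; rewrite /= amulZr. Qed.

Fact subCStar_starK : involutive subCStar_starop.
Proof. by move=> x; apply/val_inj; rewrite /= starK. Qed.

Fact subCStar_starD x y :
  subCStar_starop (x + y) = subCStar_starop x + subCStar_starop y.
Proof. by apply/val_inj; rewrite /= starD. Qed.

Fact subCStar_starZ (c : R[i]) x :
  subCStar_starop (c *: x) = Num.conj c *: subCStar_starop x.
Proof. by apply/val_inj; rewrite /= starZ. Qed.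

Fact subCStar_starM x y :
  subCStar_starop (subCStar_amul x y) =
  subCStar_amul (subCStar_starop y) (subCStar_starop x).
Proof. by apply/val_inj; rewrite /= starM. Qed.

HB.instance Definition _ := isStarAlgebra.Build R subCStar_type
  subCStar_amulA subCStar_amulDl subCStar_amulDr subCStar_amulZl subCStar_amulZr
  subCStar_starK subCStar_starD subCStar_starZ subCStar_starM.

Fact subCStar_normr0_eq0 x : `|val x| = 0 -> x = 0.
Proof. by move=> /normr0_eq0 x0; apply/val_inj. Qed.

HB.instance Definition _ := @Lmodule_isNormed.Build R[i] subCStar_type
  (fun x => `|val x|)
  (fun x y => ler_normD (val x) (val y))
  (fun c x => normrZ c (val x))
  subCStar_normr0_eq0.

Fact subCStar_complete (F : set_system subCStar_type) :
  ProperFilter F -> cauchy F -> cvg F.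
Proof.
move=> FF Fc.
have vFc : cauchy (val @ F).
  apply/cauchy_ballP => e e0; move/cauchy_ballP: Fc => /(_ _ e0).
  move=> [[P Q] [FP FQ] PQ].
  exists (val @` P, val @` Q).
    by split; [move: FP|move: FQ]; apply: filterS => x Px; exists x.
  move=> [_ _] /= [[x Px <-] [y Qy <-]].
  by have := PQ (x, y) (conj Px Qy); rewrite /= -!ball_normE.
have /cvg_ex[l vFl] : cvg (val @ F) by exact: cauchy_cvg.
have Al : subCStar_pred l.
  apply/mem_set; apply: (closed_cvg (subCStar_set A) (@subCStar_closed _ _ A) _ _ vFl).
  by near=> x; apply/set_mem/(valP x).
apply/cvg_ex; exists (Sub l Al).
apply/cvgrPdist_lt => e e0; near=> x.
rewrite /Num.norm/=.
by near: x; move/cvgrPdist_lt: vFl; exact.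
Unshelve. all: by end_near. Qed.

HB.instance Definition _ := Uniform_isComplete.Build subCStar_type
  subCStar_complete.

Fact subCStar_normr_amul x y : `|x ** y| <= `|x| * `|y|.
Proof. exact: normr_amul. Qed.

Fact subCStar_normr_starM x : `|star x ** x| = `|x| ^+ 2.
Proof. exact: normr_starM. Qed.

HB.instance Definition _ := isCStarNormed.Build R subCStar_type
  subCStar_normr_amul subCStar_normr_starM.

End SubCStarAlgebra.

Coercion subCStar_type : subCStar >-> Sortclass.

Section StarAlgebraTheory.
Context (R : realType) (A : starAlgType R).
Implicit Types x y z : A.

Lemma amul0r x : 0 ** x = 0.
Proof. by have := amulZl 0 (0 : A) x; rewrite !scale0r. Qed.

Lemma amulr0 x : x ** 0 = 0.
Proof. by have := amulZr 0 x (0 : A); rewrite !scale0r. Qed.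

Lemma amulrN x y : x ** (- y) = - (x ** y).
Proof. by rewrite -scaleN1r amulZr scaleN1r. Qed.

Lemma amulNr x y : (- x) ** y = - (x ** y).
Proof. by rewrite -scaleN1r amulZl scaleN1r. Qed.

Lemma star0 : star (0 : A) = 0.
Proof. by have := starZ 0 (0 : A); rewrite conjC0 !scale0r. Qed.

End StarAlgebraTheory.

Section CStarAlgebraTheory.
Context (R : realType) (A : cstarAlgType R).
Implicit Types x y z : A.

Lemma star_amul_eq0 x : star x ** x = 0 -> x = 0.
Proof.
by move=> xx0; apply/normr0_eq0/eqP; rewrite -sqrf_eq0 -normr_starM xx0 normr0.
Qed.

Lemma amul_injr x y : (forall z, z ** x = z ** y) -> x = y.
Proof.
move=> xy; apply/eqP; rewrite -subr_eq0; apply/eqP/star_amul_eq0.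
by rewrite amulDr amulrN xy subrr.
Qed.

Lemma amul_injl x y : (forall z, x ** z = y ** z) -> x = y.
Proof.
move=> xy; apply: (can_inj (@starK _ A)); apply: amul_injr => z.
by rewrite -[z]starK -!starM xy.
Qed.

Lemma normr_star x : `|star x| = `|x|.
Proof.
suff le y : `|y| <= `|star y|.
  by apply/le_anti; rewrite le andbT -{2}[x]starK le.
have [->|y0] := eqVneq y 0; first by rewrite star0.
by rewrite -(@ler_pM2r _ `|y|) ?normr_gt0// -expr2 -normr_starM normr_amul.
Qed.

Lemma cvg_amulr (T : Type) (F : set_system T) (FF : Filter F) (f : T -> A) a l :
  f @ F --> l -> (a ** f t) @[t --> F] --> a ** l.
Proof.
move=> /cvgrPdist_lt fl; apply/cvgrPdist_lt => e e0.
have a0 : 0 < `|a| + 1 by rewrite ltr_wpDl.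
near=> t; rewrite -amulrN -amulDr (le_lt_trans (normr_amul _ _))//.
rewrite (@le_lt_trans _ _ ((`|a| + 1) * `|l - f t|))//.
  by rewrite ler_wpM2r// lerDl.
by rewrite -ltr_pdivlMl//; near: t; apply: fl; rewrite mulr_gt0// invr_gt0.
Unshelve. all: by end_near. Qed.

Lemma cvg_amull (T : Type) (F : set_system T) (FF : Filter F) (f : T -> A) a l :
  f @ F --> l -> (f t ** a) @[t --> F] --> l ** a.
Proof.
move=> /cvgrPdist_lt fl; apply/cvgrPdist_lt => e e0.
have a0 : 0 < `|a| + 1 by rewrite ltr_wpDl.
near=> t; rewrite -amulNr -amulDl (le_lt_trans (normr_amul _ _))//.
rewrite (@le_lt_trans _ _ (`|l - f t| * (`|a| + 1)))//.
  by rewrite ler_wpM2l// lerDl.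
by rewrite -ltr_pdivlMr//; near: t; apply: fl; rewrite divr_gt0.
Unshelve. all: by end_near. Qed.

End CStarAlgebraTheory.

Section Multiplier.
Context (R : realType) (A : cstarAlgType R).

Fact norm_realE (c : R[i]) : exists r : R, (r%:C)%C = `|c|.
Proof. by exists (complex.Re `|c|); rewrite RRe_real ?normr_real. Qed.

Definition bounded_map (f : A -> A) :=
  exists M : R, forall x, `|f x| <= (M%:C)%C * `|x|.

(* Double centralizers (L, R) : bounded linear maps with a L(b) = R(a) b. The
   identities L(ab) = L(a) b and R(ab) = a R(b) follow (lmultM, rmultM). *)
Record multiplier := Multiplier {
  lmult : A -> A;
  rmult : A -> A;
  lmult_linear : linear lmult;
  rmult_linear : linear rmult;
  lmult_bounded : bounded_map lmult;
  rmult_bounded : bounded_map rmult;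
  multiplierP : forall a b, a ** lmult b = rmult a ** b
}.

HB.instance Definition _ := gen_eqMixin multiplier.
HB.instance Definition _ := gen_choiceMixin multiplier.

HB.instance Definition _ (m : multiplier) :=
  GRing.isLinear.Build R[i] A A _ (lmult m) (lmult_linear m).
HB.instance Definition _ (m : multiplier) :=
  GRing.isLinear.Build R[i] A A _ (rmult m) (rmult_linear m).

Implicit Types (m n p : multiplier) (a b : A).

Lemma lmultM m a b : lmult m (a ** b) = lmult m a ** b.
Proof. by apply: amul_injr => c; rewrite multiplierP !amulA multiplierP. Qed.

Lemma rmultM m a b : rmult m (a ** b) = a ** rmult m b.
Proof. by apply: amul_injl => c; rewrite -multiplierP -!amulA multiplierP. Qed.

Lemma multiplier_eqP m n : lmult m = lmult n -> m = n.
Proof.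
move=> lmn; have rmn : rmult m = rmult n.
  apply/funext => a; apply: amul_injl => b.
  by rewrite -!multiplierP lmn.
case: m n lmn rmn => [l r l1 r1 lb rb lr] [l' r' l1' r1' lb' rb' lr'] /= ll rr.
subst l' r'.
by congr Multiplier; exact: Prop_irrelevance.
Qed.

Fact bounded_mapD (f g : A -> A) :
  bounded_map f -> bounded_map g -> bounded_map (fun a => f a + g a).
Proof.
move=> [M fM] [N gN]; exists (M + N) => x.
by rewrite rmorphD/= mulrDl (le_trans (ler_normD _ _))// lerD.
Qed.

Fact bounded_mapZ (c : R[i]) (f : A -> A) :
  bounded_map f -> bounded_map (fun a => c *: f a).
Proof.
move=> [M fM]; have [N NE] := norm_realE c; exists (N * M) => x.
rewrite normrZ rmorphM/= NE -mulrA.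
by rewrite ler_wpM2l.
Qed.

Fact bounded_map_comp (f g : A -> A) :
  bounded_map f -> bounded_map g -> bounded_map (f \o g).
Proof.
move=> [M fM] [N gN]; exists (`|M| * N) => x /=.
rewrite (le_trans (fM _))// rmorphM/= -mulrA.
rewrite (@le_trans _ _ ((`|M|%:C)%C * `|g x|))//.
  by rewrite ler_wpM2r// lecR ler_norm.
by rewrite ler_wpM2l// lecR.
Qed.

Fact bounded_map_star (f : A -> A) :
  bounded_map f -> bounded_map (fun a => star (f (star a))).
Proof.
by move=> [M fM]; exists M => x; rewrite normr_star -[in leRHS](normr_star x).
Qed.

Fact bounded_map0 : bounded_map (fun=> 0).
Proof. by exists 0 => x; rewrite normr0 mul0r. Qed.

Fact bounded_mapMl a : bounded_map (fun b => a ** b).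
Proof.
have [N NE] := norm_realE `|a|; exists N => x.
by rewrite NE normr_id normr_amul.
Qed.

Fact bounded_mapMr a : bounded_map (fun b => b ** a).
Proof.
have [N NE] := norm_realE `|a|; exists N => x; rewrite NE normr_id mulrC.
exact: normr_amul.
Qed.

Program Definition mult0 : multiplier :=
  @Multiplier (fun=> 0) (fun=> 0) _ _ bounded_map0 bounded_map0 _.
Next Obligation. by move=> c a b; rewrite scaler0 addr0. Qed.
Next Obligation. by move=> c a b; rewrite scaler0 addr0. Qed.
Next Obligation. by move=> a b; rewrite amul0r amulr0. Qed.

Program Definition multD m n : multiplier :=
  @Multiplier (fun a => lmult m a + lmult n a) (fun a => rmult m a + rmult n a)
    _ _ (bounded_mapD (lmult_bounded m) (lmult_bounded n))
    (bounded_mapD (rmult_bounded m) (rmult_bounded n)) _.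
Next Obligation. by move=> m n c a b; rewrite !linearP scalerDr addrACA. Qed.
Next Obligation. by move=> m n c a b; rewrite !linearP scalerDr addrACA. Qed.
Next Obligation. by move=> m n a b; rewrite amulDr amulDl !multiplierP. Qed.

Program Definition multZ (k : R[i]) m : multiplier :=
  @Multiplier (fun a => k *: lmult m a) (fun a => k *: rmult m a)
    _ _ (bounded_mapZ k (lmult_bounded m)) (bounded_mapZ k (rmult_bounded m)) _.
Next Obligation.
by move=> k m c a b; rewrite linearP scalerDr !scalerA mulrC.
Qed.
Next Obligation.
by move=> k m c a b; rewrite linearP scalerDr !scalerA mulrC.
Qed.
Next Obligation. by move=> k m a b; rewrite amulZr amulZl multiplierP. Qed.

(* (L1, R1) (L2, R2) = (L1 L2, R2 R1) *)
Program Definition multM m n : multiplier :=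
  @Multiplier (lmult m \o lmult n) (rmult n \o rmult m) _ _
    (bounded_map_comp (lmult_bounded m) (lmult_bounded n))
    (bounded_map_comp (rmult_bounded n) (rmult_bounded m)) _.
Next Obligation. by move=> m n c a b; rewrite /= !linearP. Qed.
Next Obligation. by move=> m n c a b; rewrite /= !linearP. Qed.
Next Obligation. by move=> m n a b; rewrite /= !multiplierP. Qed.

(* (L, R)^* = (a |-> R(a^* )^*, a |-> L(a^* )^* ) *)
Program Definition mult_star m : multiplier :=
  @Multiplier (fun a => star (rmult m (star a)))
    (fun a => star (lmult m (star a))) _ _
    (bounded_map_star (rmult_bounded m)) (bounded_map_star (lmult_bounded m)) _.
Next Obligation.
by move=> m c a b; rewrite starD starZ linearP starD starZ conjCK.
Qed.
Next Obligation.
by move=> m c a b; rewrite starD starZ linearP starD starZ conjCK.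
Qed.
Next Obligation.
by move=> m a b; rewrite -[a in LHS]starK -[b in RHS]starK -!starM multiplierP.
Qed.

(* The canonical embedding A -> M(A). *)
Program Definition mult_of a : multiplier :=
  @Multiplier (fun b => a ** b) (fun b => b ** a) _ _
    (bounded_mapMl a) (bounded_mapMr a) _.
Next Obligation. by move=> a c x y; rewrite amulDr amulZr. Qed.
Next Obligation. by move=> a c x y; rewrite amulDl amulZl. Qed.
Next Obligation. by move=> a x y; rewrite amulA. Qed.

Fact multDA : associative multD.
Proof. by move=> m n p; apply/multiplier_eqP/funext => a /=; rewrite addrA. Qed.

Fact multDC : commutative multD.
Proof. by move=> m n; apply/multiplier_eqP/funext => a /=; rewrite addrC. Qed.

Fact mult0D : left_id mult0 multD.
Proof. by move=> m; apply/multiplier_eqP/funext => a /=; rewrite add0r. Qed.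

Fact multND : left_inverse mult0 (multZ (-1)) multD.
Proof.
by move=> m; apply/multiplier_eqP/funext => a /=; rewrite scaleN1r addNr.
Qed.

HB.instance Definition _ :=
  GRing.isZmodule.Build multiplier multDA multDC mult0D multND.

Fact multZA (c d : R[i]) m : multZ c (multZ d m) = multZ (c * d) m.
Proof. by apply/multiplier_eqP/funext => a /=; rewrite scalerA. Qed.

Fact mult1Z : left_id 1 multZ.
Proof. by move=> m; apply/multiplier_eqP/funext => a /=; rewrite scale1r. Qed.

Fact multZDr : right_distributive multZ +%R.
Proof. by move=> c m n; apply/multiplier_eqP/funext => a /=; rewrite scalerDr. Qed.

Fact multZDl m : {morph multZ^~ m : c d / c + d}.
Proof. by move=> c d; apply/multiplier_eqP/funext => a /=; rewrite scalerDl. Qed.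

HB.instance Definition _ := GRing.Zmodule_isLmodule.Build R[i] multiplier
  multZA mult1Z multZDr multZDl.

Fact multMA : associative multM.
Proof. by move=> m n p; exact/multiplier_eqP. Qed.

Fact multMDl m n p : multM (m + n) p = multM m p + multM n p.
Proof. exact/multiplier_eqP. Qed.

Fact multMDr m n p : multM m (n + p) = multM m n + multM m p.
Proof. by apply/multiplier_eqP/funext => a /=; rewrite linearD. Qed.

Fact multMZl (c : R[i]) m n : multM (c *: m) n = c *: multM m n.
Proof. exact/multiplier_eqP. Qed.

Fact multMZr (c : R[i]) m n : multM m (c *: n) = c *: multM m n.
Proof. by apply/multiplier_eqP/funext => a /=; rewrite linearZ. Qed.

Fact mult_starK : involutive mult_star.
Proof. by move=> m; apply/multiplier_eqP/funext => a /=; rewrite !starK. Qed.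

Fact mult_starD m n : mult_star (m + n) = mult_star m + mult_star n.
Proof. by apply/multiplier_eqP/funext => a /=; rewrite starD. Qed.

Fact mult_starZ (c : R[i]) m : mult_star (c *: m) = Num.conj c *: mult_star m.
Proof. by apply/multiplier_eqP/funext => a /=; rewrite starZ. Qed.

Fact mult_starM m n :
  mult_star (multM m n) = multM (mult_star n) (mult_star m).
Proof. by apply/multiplier_eqP/funext => a /=; rewrite starK. Qed.

HB.instance Definition _ := isStarAlgebra.Build R multiplier
  multMA multMDl multMDr multMZl multMZr
  mult_starK mult_starD mult_starZ mult_starM.

(* The operator norm of L. *)
Definition mult_norm m : R[i] :=
  ((sup [set complex.Re `|lmult m a| | a in [set a : A | `|a| <= 1%R]])%:C)%C.

Lemma mult_normP m : 0 <= mult_norm m /\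
  forall a, `|lmult m a| <= mult_norm m * `|a|.
Proof.
rewrite /mult_norm; set E := (X in sup X).
have E0 : E 0 by exists 0 => /=; rewrite ?normr0 ?ler01// linear0 normr0.
have Eub : has_ubound E.
  have [M lM] := lmult_bounded m; exists `|M| => _ [a /= a1 <-].
  rewrite -lecR RRe_real ?normr_real// (le_trans (lM a))//.
  rewrite (@le_trans _ _ ((`|M|%:C)%C * `|a|))//.
    by rewrite ler_wpM2r// lecR ler_norm.
  by rewrite ler_piMr// lecR.
split; first by rewrite lecR; apply: ub_le_sup.
move=> a; have [->|a0] := eqVneq a 0; first by rewrite linear0 !normr0 mulr0.
rewrite -ler_pdivrMr ?normr_gt0//.
pose b := (`|a|^-1 : R[i]) *: a.
have b1 : `|b| <= 1.
  by rewrite normrZ normrV ?unitfE ?normr_eq0// normr_id mulVf ?normr_eq0.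
have -> : `|lmult m a| / `|a| = `|lmult m b|.
  by rewrite linearZ normrZ normrV ?unitfE ?normr_eq0// normr_id mulrC.
rewrite -[leLHS](@RRe_real R) ?normr_real// lecR.
by apply: ub_le_sup => //; exists b.
Qed.

Lemma mult_norm_ge0 m : 0 <= mult_norm m.
Proof. by case: (mult_normP m). Qed.

Lemma lmult_le m a : `|lmult m a| <= mult_norm m * `|a|.
Proof. by case: (mult_normP m). Qed.

Lemma mult_norm_le m (M : R[i]) : 0 <= M ->
  (forall a, `|lmult m a| <= M * `|a|) -> mult_norm m <= M.
Proof.
move=> M0 lM; rewrite /mult_norm -[leRHS](@RRe_real R) ?ger0_real// lecR.
apply: ge_sup.
  by exists 0; exists 0 => /=; rewrite ?normr0 ?ler01// linear0 normr0.
move=> _ [a /= a1 <-]; rewrite -lecR !RRe_real ?ger0_real//.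
by rewrite (le_trans (lM a))// ler_piMr.
Qed.

Lemma rmult_le m a : `|rmult m a| <= mult_norm m * `|a|.
Proof.
have [r0|r0] := eqVneq `|rmult m a| 0.
  by rewrite r0 mulr_ge0// mult_norm_ge0.
rewrite -(@ler_pM2r _ `|rmult m a|) ?lt_def ?r0 ?normr_ge0//.
rewrite -expr2 -[in leLHS](normr_star (rmult m a)) -normr_starM starK.
rewrite -multiplierP (le_trans (normr_amul _ _))//.
rewrite [leRHS]mulrAC mulrC ler_wpM2r//.
by rewrite (le_trans (lmult_le _ _))// normr_star.
Qed.

Fact mult_normD m n : mult_norm (m + n) <= mult_norm m + mult_norm n.
Proof.
apply: mult_norm_le; first by rewrite addr_ge0// mult_norm_ge0.
move=> a; rewrite mulrDl (le_trans (ler_normD _ _))//.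
by rewrite lerD// lmult_le.
Qed.

Fact mult_normZ (c : R[i]) m : mult_norm (c *: m) = `|c| * mult_norm m.
Proof.
have le d n : mult_norm (d *: n) <= `|d| * mult_norm n.
  apply: mult_norm_le; first by rewrite mulr_ge0// mult_norm_ge0.
  by move=> a; rewrite /= normrZ -mulrA ler_wpM2l// lmult_le.
apply/le_anti; rewrite le/=.
have [->|c0] := eqVneq c 0; first by rewrite normr0 mul0r mult_norm_ge0.
rewrite -ler_pdivlMl ?normr_gt0// -normfV.
by rewrite -[in leLHS](scalerK c0 m) le.
Qed.

Fact mult_norm_eq0 m : mult_norm m = 0 -> m = 0.
Proof.
move=> m0; apply/multiplier_eqP/funext => a /=; apply/normr0_eq0/le_anti.
by rewrite normr_ge0 andbT (le_trans (lmult_le m a))// m0 mul0r.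
Qed.

HB.instance Definition _ := @Lmodule_isNormed.Build R[i] multiplier
  mult_norm mult_normD mult_normZ mult_norm_eq0.

Fact mult_complete (F : set_system multiplier) :
  ProperFilter F -> cauchy F -> cvg F.
Proof.
move=> FF /cauchy_ballP Fc.
have Fe (e : R[i]) : 0 < e -> exists2 P : set multiplier, F P &
    forall m n, P m -> P n -> mult_norm (m - n) < e.
  move=> e0; have [[P Q] [FP FQ] PQ] := Fc _ e0.
  exists (P `&` Q); first exact: filterI.
  move=> m n [Pm _] [_ Qn]; have := PQ (m, n) (conj Pm Qn).
  by rewrite /= -ball_normE.
have cvgF (f : multiplier -> A -> A) : (forall m n a, f (m - n) a = f m a - f n a) ->
    (forall m a, `|f m a| <= mult_norm m * `|a|) ->
    forall a, cvg (f m a @[m --> F]).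
  move=> fB fle a; apply: cauchy_cvg; apply/cauchy_ballP => e e0.
  have a0 : 0 < `|a| + 1 by rewrite ltr_wpDl.
  have [P FP PP] := Fe _ (divr_gt0 e0 a0).
  exists ((fun m => f m a) @` P, (fun m => f m a) @` P).
    by split; apply: (@filterS _ F _ P) => // m Pm; exists m.
  move=> [_ _] /= [[m Pm <-] [n Pn <-]]; rewrite -ball_normE /=.
  rewrite -fB (le_lt_trans (fle _ _))//.
  rewrite (@le_lt_trans _ _ (mult_norm (m - n) * (`|a| + 1)))//.
    by rewrite ler_wpM2l ?mult_norm_ge0// lerDl.
  by rewrite -ltr_pdivlMr// PP.
have lcvg := cvgF lmult.
have rcvg := cvgF rmult.
pose l a := lim (lmult m a @[m --> F]).
pose r a := lim (rmult m a @[m --> F]).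
have lF a : lmult m a @[m --> F] --> l a.
  by apply: lcvg => [m n b|m b]; [rewrite /= scaleN1r|exact: lmult_le].
have rF a : rmult m a @[m --> F] --> r a.
  by apply: rcvg => [m n b|m b]; [rewrite /= scaleN1r|exact: rmult_le].
have limle (f : multiplier -> A -> A) (g : A -> A) :
    (forall m n a, f (m - n) a = f m a - f n a) ->
    (forall m a, `|f m a| <= mult_norm m * `|a|) ->
    (forall a, f m a @[m --> F] --> g a) ->
    forall e : R[i], 0 < e -> \forall m \near F,
      forall a, `|g a - f m a| <= e * `|a|.
  move=> fB fle fg e e0; have [P FP PP] := Fe _ e0.
  apply: (filterS _ FP) => m Pm a.
  have /cvgrPdist_le h := fg a; apply/ler_addgt0Pr => d d0.
  near F => n.
  have Pn : P n by near: n.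
  have hn : `|g a - f n a| <= d by near: n; exact: (h d d0).
  rewrite (le_trans (ler_distD (f n a) _ _))// addrC lerD//.
  by rewrite -fB (le_trans (fle _ _))// ler_wpM2r// ltW// PP.
have lle := limle lmult l (fun m n b => ltac:(by rewrite /= scaleN1r)) lmult_le lF.
have rle := limle rmult r (fun m n b => ltac:(by rewrite /= scaleN1r)) rmult_le rF.
have llin : linear l.
  move=> c a b; apply: (cvg_unique (@norm_hausdorff _ _) (lF _)).
  have -> : (fun m => lmult m (c *: a + b)) = (fun m => c *: lmult m a + lmult m b).
    by apply/funext => m; rewrite linearP.
  by apply: cvgD => //; apply: cvgZr.
have rlin : linear r.
  move=> c a b; apply: (cvg_unique (@norm_hausdorff _ _) (rF _)).
  have -> : (fun m => rmult m (c *: a + b)) = (fun m => c *: rmult m a + rmult m b).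
    by apply/funext => m; rewrite linearP.
  by apply: cvgD => //; apply: cvgZr.
have bnd (f : multiplier -> A -> A) g : (forall m, bounded_map (f m)) ->
    (\forall m \near F, forall a, `|g a - f m a| <= 1 * `|a|) -> bounded_map g.
  move=> fb fg; near F => m; have [M fM] := fb m.
  exists (1 + M) => a; rewrite -[g a](subrK (f m a)).
  rewrite rmorphD/= mulrDl (le_trans (ler_normD _ _))// lerD//.
  by move: a; near: m.
have lb : bounded_map l by apply: bnd (lle _ ltr01); exact: lmult_bounded.
have rb : bounded_map r by apply: bnd (rle _ ltr01); exact: rmult_bounded.
have lr a b : a ** l b = r a ** b.
  have alb : a ** lmult m b @[m --> F] --> a ** l b by exact: cvg_amulr.
  apply: (cvg_unique (@norm_hausdorff _ _) alb).
  have -> : (fun m => a ** lmult m b) = (fun m => rmult m a ** b).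
    by apply/funext => m; rewrite multiplierP.
  exact: cvg_amull.
apply/cvg_ex; exists (Multiplier llin rlin lb rb lr).
apply/cvgrPdist_le => e e0; near=> m.
apply: mult_norm_le; first exact: ltW.
by rewrite /= => a; rewrite scaleN1r; move: a; near: m; exact: lle.
Unshelve. all: by end_near. Qed.

HB.instance Definition _ := Uniform_isComplete.Build multiplier mult_complete.

Fact mult_normr_amul m n : `|m ** n| <= `|m| * `|n|.
Proof.
apply: mult_norm_le; first by rewrite mulr_ge0.
move=> a /=; rewrite (le_trans (lmult_le m _))// -mulrA.
by rewrite ler_wpM2l ?mult_norm_ge0// lmult_le.
Qed.

Fact mult_normr_starM m : `|star m ** m| = `|m| ^+ 2.
Proof.
have le n : `|n| ^+ 2 <= `|star n ** n|.
  have q0 : 0 <= sqrtC `|star n ** n| by rewrite sqrtC_ge0.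
  rewrite -[leRHS]sqrtCK lerXn2r ?nnegrE ?normr_ge0//.
  apply: mult_norm_le => // a; rewrite -(@ler_pXn2r _ 2) ?nnegrE ?mulr_ge0//.
  rewrite -normr_starM multiplierP exprMn sqrtCK expr2 mulrA.
  rewrite (le_trans (normr_amul _ _))// ler_wpM2r//.
  by rewrite -[leLHS]normr_star; exact: (lmult_le (star n ** n) a).
have star_le : `|star m| <= `|m|.
  have [->|m0] := eqVneq `|star m| 0; first by rewrite normr_ge0.
  rewrite -(@ler_pM2r _ `|star m|) ?lt_def ?m0 ?normr_ge0//.
  by rewrite -expr2 (le_trans (le _))// starK mult_normr_amul.
apply/le_anti; rewrite le andbT (le_trans (mult_normr_amul _ _))// expr2.
by rewrite ler_wpM2r.
Qed.

HB.instance Definition _ := isCStarNormed.Build R multiplier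
  mult_normr_amul mult_normr_starM.

End Multiplier.

(* M(A) acts on A by (L, R) . a = L a: the product in M(A) of m with the
   canonical image of a is the canonical image of lmult m a. *)
Lemma amul_mult_of (R : realType) (A : cstarAlgType R) (m : multiplier A) (a : A) :
  m ** mult_of a = mult_of (lmult m a).
Proof. by apply/multiplier_eqP/funext => b /=; rewrite lmultM. Qed.

Definition star_morphism (R : realType) (A B : starAlgType R) (f : A -> B) :=
  [/\ linear f, {morph f : x y / x ** y} & {morph f : x / star x}].

Lemma mult_of_morphism (R : realType) (A : cstarAlgType R) :
  star_morphism (@mult_of R A) /\ injective (@mult_of R A).
Proof.
split; last first.
  by move=> a b ab; apply: amul_injl => c; have := congr1 (@lmult _ _ ^~ c) ab.
split=> [c a b|a b|a]; apply/multiplier_eqP/funext => x /=.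
- by rewrite amulDl amulZl.
- by rewrite amulA.
- by rewrite starM starK.
Qed.

Definition lspan (K : nzRingType) (V : lmodType K) (E : set V) : set V :=
  [set x | exists n (c : 'I_n -> K) (v : 'I_n -> V),
    (forall k, E (v k)) /\ x = \sum_(k < n) c k *: v k].

(* graded_free is the linear independence of the family of subspaces A i: the
   sum ranges over the finite support of S. *)
Record graded (R : realType) (d : Order.disp_t) (L : meetSemilatticeType d)
    (B : cstarAlgType R) (A : L -> subCStar B) : Prop := Graded {
  graded_free : forall S : L -> B, (forall i, subCStar_set (A i) (S i)) ->
    finite_set [set i | S i != 0] -> \sum_(i \in [set: L]) S i = 0 ->
    forall i, S i = 0;
  graded_total : dense (lspan (\bigcup_i subCStar_set (A i)));
  graded_amul : forall (i j : L) x y,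
    subCStar_set (A i) x -> subCStar_set (A j) y ->
    subCStar_set (A (Order.meet i j)) (x ** y)
}.

(* Main.v *)
Require Import Defs.
From HB Require Import structures.
From mathcomp Require Import all_boot all_order all_algebra.
From mathcomp Require Import sesquilinear complex.
From mathcomp Require Import boolp classical_sets functions cardinality fsbigop.
From mathcomp Require Import reals topology normedtype.

Import Order.TTheory GRing.Theory Num.Theory.
Import numFieldNormedType.Exports.

Local Open Scope ring_scope.

(** The argument rests on the inclusion of A_j A_i in A_k, where k is the meet
    of i and j. When i <= j it says that A_j multiplies A_i into itself from the
    left and, by taking adjoints, also from the right; so left and right
    multiplication by an element y of A_j form a double centralizer of A_i,
    which is the value at y of the morphism from A_j to M(A_i) ([mult_restr]).
    The maps q are the product of the ambient algebra, corestricted to A_k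
    ([amul_restr]).

    Every identity claimed is then an instance of a law of the ambient algebra,
    since an element of a subalgebra is determined by its value there, and a
    multiplier by its left action ([multiplier_eqP]). In particular, for x in
    A_i and y in A_j, composing the left actions of x and y on A_k or on a
    smaller component A_m is left multiplication by xy, by associativity; hence
    the product of the images of x and y in M(A_k) is xy itself, and the
    compatibility with M(A_m) follows. *)

Section RestrictedMultiplication.
Context {R : realType} {B : cstarAlgType R}.

Section Product.
Context {I J K : subCStar B}.
Context (IJK : forall x y, subCStar_set I x -> subCStar_set J y ->
  subCStar_set K (x ** y)).

Lemma amul_restr_subproof (x : I) (y : J) : subCStar_pred K (val x ** val y).
Proof. by apply/mem_set/IJK; apply/set_mem/(valP _). Qed.

Definition amul_restr (x : I) (y : J) : K := Sub _ (amul_restr_subproof x y).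

Lemma amul_restr_bilinear : bilinear_for *:%R *:%R amul_restr.
Proof.
by split=> [y c x x'|x c y y']; apply/val_inj;
  rewrite /= ?amulDl ?amulDr ?amulZl ?amulZr.
Qed.

(** Adjoints reverse the two factors, so a bound on I J also bounds J I; this
    supplies the right action of a multiplier from its left action. *)
Lemma amul_restr_starP x y : subCStar_set J x -> subCStar_set I y ->
  subCStar_set K (x ** y).
Proof.
move=> Jx Iy; rewrite -[x ** y]starK starM.
by apply/subCStar_star/IJK; apply/subCStar_star.
Qed.

End Product.

Section LeftAction.
Context {I J : subCStar B}.
Context (JI : forall y x, subCStar_set J y -> subCStar_set I x ->
  subCStar_set I (y ** x)).

Program Definition mult_restr (y : J) : multiplier I :=
  @Multiplier R I (amul_restr JI y) (fun x => amul_restr (amul_restr_starP JI) x y)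
    _ _ _ _ _.
Next Obligation. by move=> y; exact: (amul_restr_bilinear JI).2. Qed.
Next Obligation.
by move=> y; exact: (amul_restr_bilinear (amul_restr_starP JI)).1.
Qed.
Next Obligation.
by move=> y; have [M yM] := bounded_mapMl (val y); exists M => x; exact: yM.
Qed.
Next Obligation.
by move=> y; have [M yM] := bounded_mapMr (val y); exists M => x; exact: yM.
Qed.
Next Obligation. by move=> y a b; apply/val_inj; rewrite /= amulA. Qed.

Lemma mult_restr_morphism : star_morphism mult_restr.
Proof.
split=> [c x y|x y|x]; apply/multiplier_eqP/funext => z; apply/val_inj => /=.
- by rewrite amulDl amulZl.
- by rewrite amulA.
- by rewrite starM starK.
Qed.

Lemma mult_restr_unique (f : J -> multiplier I) :
  (forall y x, val (lmult (f y) x) = val y ** val x) -> mult_restr = f.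
Proof.
move=> fE; apply/funext => y; apply/multiplier_eqP/funext => x.
by apply/val_inj; rewrite fE.
Qed.

End LeftAction.

End RestrictedMultiplication.

Theorem proposition2p5p1 (R : realType) (d : Order.disp_t)
    (L : meetSemilatticeType d) (B : cstarAlgType R) (A : L -> subCStar B)
    (gradedA : graded A) :
  (exists phi : forall i j : L, (i <= j)%O -> A j -> multiplier (A i),
    [/\ forall (i j : L) (ij : (i <= j)%O),
          unique (fun f : A j -> multiplier (A i) =>
              star_morphism f /\
              forall (y : A j) (x : A i), val (lmult (f y) x) = val y ** val x)
            (phi i j ij),
        forall i : L, phi i i (lexx i) = @mult_of R (A i)
      & forall i j : L, let k := (i `&` j)%O in
        forall (m : L) (mk : (m <= k)%O) (x : A i) (y : A j),
        exists2 z : A k,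
          phi k i (leIl i j) x ** phi k j (leIr j i) y = mult_of z
        & phi m k mk z = phi m i (le_trans mk (leIl i j)) x
                         ** phi m j (le_trans mk (leIr j i)) y]) /\
  (exists q : forall i j : L, A i -> A j -> A (i `&` j)%O,
    [/\ forall i j : L,
          unique (fun f : A i -> A j -> A (i `&` j)%O =>
              forall (x : A i) (y : A j), val (f x y) = val x ** val y)
            (q i j),
        forall i j : L, bilinear_for *:%R *:%R (q i j),
        forall (i : L) (x y : A i), val (q i i x y) = val (x ** y),
        forall (i j : L) (x : A i) (y : A j),
          val (q i j x y) = val (star (q j i (star y) (star x)))
      & forall (i j k : L) (x : A i) (y : A j) (z : A k),
          val (q (i `&` j)%O k (q i j x y) z) =
          val (q i (j `&` k)%O x (q j k y z))]).
Proof.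
have JI i j : (i <= j)%O -> forall y x, subCStar_set (A j) y ->
    subCStar_set (A i) x -> subCStar_set (A i) (y ** x).
  by move=> ij y x yA xA; have := graded_amul gradedA yA xA; rewrite meet_r.
split.
  exists (fun i j ij => mult_restr (JI i j ij)); split.
  - move=> i j ij; split; last by move=> f [_]; exact: mult_restr_unique.
    by split; first exact: mult_restr_morphism.
  - by move=> i; apply: mult_restr_unique.
  - move=> i j k m mk x y; exists (amul_restr (@graded_amul _ _ _ _ _ gradedA i j) x y);
    by apply/multiplier_eqP/funext => z; apply/val_inj; rewrite /= amulA.
exists (fun i j => amul_restr (@graded_amul _ _ _ _ _ gradedA i j)); split.
- move=> i j; split=> // f fE.
  by apply/funext => x; apply/funext => y; apply/val_inj; rewrite fE.
- by move=> i j; exact: amul_restr_bilinear.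
- by [].
- by move=> i j x y; rewrite /= starM !starK.
- by move=> i j k x y z; rewrite /= amulA.
Qed.
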